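(* Let $\hat F$ be a regular admissible extended frame on a domain $\Omega\subset\mathbb R^2$, with coefficients $A^i,B^i$, and write $F=\hat F|_{\lambda=1}$. For every $\mu\in\mathbb R$, $\mu\ne0,1$, the map $$f^\mu:=\hat F|_{\lambda=\mu}\,\hat F|_{\lambda=1}^{-1}:\Omega\longrightarrow\mathbb H^3_1$$ is a timelike immersion with unit normal $N^\mu=\hat F|_{\lambda=\mu}\,e_3\,\hat F|_{\lambda=1}^{-1}$, Gauss map $\nu=\mathrm{Ad}_Fe_3$, and constant mean curvature $$H=\frac{\mu+1}{\mu-1}.$$ Moreover $$(f^\mu)^{-1}f^\mu_x=A^1(\mu-1)\,\mathrm{Ad}_F\xi_1,\qquad (f^\mu)^{-1}f^\mu_y=B^2(\mu^{-1}-1)\,\mathrm{Ad}_F\xi_2.$$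
   Context: Ambient space. On the space $\mathfrak{gl}(2,\mathbb R)$ of real $2\times2$ matrices let $\langle X,Y\rangle=-\tfrac12\operatorname{tr}(X\bar Y)$, where $\bar Y=(\operatorname{tr}Y)\mathrm{Id}-Y$; then $\langle X,X\rangle=-\det X$. Anti-de Sitter 3-space is $\mathbb H^3_1=\{X:\langle X,X\rangle=-1\}=SL(2,\mathbb R)$ with the induced Lorentzian metric. Put $e_3=\begin{pmatrix}-1&0\\0&1\end{pmatrix}$, $\xi_1=\begin{pmatrix}0&0\\1&0\end{pmatrix}$, $\xi_2=\begin{pmatrix}0&1\\0&0\end{pmatrix}$, $\mathrm{Ad}_FX=FXF^{-1}$. All maps are smooth; a domain is a connected open set with coordinates $(x,y)$. An immersion $f:\Omega\to\mathbb H^3_1$ is timelike if the induced metric is Lorentzian. A unit normal is $N$ with $\langle N,N\rangle=1$ and $N$ orthogonal to $f,f_x,f_y$; the Gauss map is $f^{-1}N$. The shape operator $S$ is defined by $S(f_x,f_y)^T=(N_x,N_y)^T$ and the mean curvature is $H=-\tfrac12\operatorname{tr}S$; when $(x,y)$ are null coordinates for the induced metric this is $H=\langle f_{xy},N\rangle/\langle f_x,f_y\rangle$. An admissible extended frame on $\Omega$ is a family of maps $\hat F|_\lambda:\Omega\to SL(2,\mathbb R)$, depending smoothly on the spectral parameter $\lambda\in\mathbb R\setminus\{0\}$ (i.e. a map into the loop group $\Lambda SL(2,\mathbb R)$), with $$\hat F^{-1}d\hat F=(\lambda A^1\xi_1+A^2\xi_2+A^3e_3)\,dx+(B^1\xi_1+\lambda^{-1}B^2\xi_2+B^3e_3)\,dy,$$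 where $A^i,B^i$ are real functions of $(x,y)$ independent of $\lambda$. It is regular if $A^1\ne0$ and $B^2\ne0$ everywhere on $\Omega$. *)

(* Defs.v *)
From HB Require Import structures.
From mathcomp Require Import all_boot all_order all_algebra.
From mathcomp Require Import all_classical all_reals all_analysis.

Set Implicit Arguments.
Unset Strict Implicit.
Unset Printing Implicit Defensive.

Import Order.TTheory GRing.Theory Num.Theory.
Import numFieldNormedType.Exports.

Local Open Scope classical_set_scope.
Local Open Scope ring_scope.

Section Smoothness.
Variables (R : realType) (V W : normedModType R).

(* Only the values of [f] on [U] matter, provided [U] is open. *)
Fixpoint Ck_on (k : nat) (U : set V) (f : V -> W) : Prop :=
  if k is k'.+1 then
    (forall p, U p -> differentiable f p) /\ (forall v, Ck_on k' U ('D_v f))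
  else forall p, U p -> {for p, continuous f}.

Definition smooth_on (U : set V) (f : V -> W) : Prop :=
  forall k, Ck_on k U f.

End Smoothness.

Section AntiDeSitter.
Variable R : realType.

Definition ads_conj (Y : 'M[R]_2) : 'M[R]_2 := (\tr Y)%:M - Y.

Definition ads_ip (X Y : 'M[R]_2) : R := - 2^-1 * \tr (X *m ads_conj Y).

(* As [ads_ip X X = - \det X], this is SL(2, R). *)
Definition AdS3 : set 'M[R]_2 := [set X | ads_ip X X = -1].

Definition e3 : 'M[R]_2 := delta_mx 1 1 - delta_mx 0 0.
Definition xi1 : 'M[R]_2 := delta_mx 1 0.
Definition xi2 : 'M[R]_2 := delta_mx 0 1.

Definition Ad (F X : 'M[R]_2) : 'M[R]_2 := F *m X *m invmx F.

End AntiDeSitter.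

Section Surfaces.
Variable R : realType.
Implicit Types (Omega : set (R * R)) (f N : R * R -> 'M[R]_2) (p v w : R * R).

Definition is_domain Omega : Prop := open Omega /\ connected Omega.

Definition Dx f : R * R -> 'M[R]_2 := 'D_((1, 0) : R * R) f.
Definition Dy f : R * R -> 'M[R]_2 := 'D_((0, 1) : R * R) f.

Definition induced_metric f p v w : R := ads_ip ('d f p v) ('d f p w).

(* Signature (1, 1) for a symmetric bilinear form on the plane: there is a
   pseudo-orthonormal basis. The three equations make [v], [w] independent. *)
Definition lorentzian (g : R * R -> R * R -> R) : Prop :=
  exists v w, [/\ g v v = -1, g w w = 1 & g v w = 0].

Definition immersion Omega f : Prop :=
  smooth_on Omega f /\ (forall p, Omega p -> injective ('d f p)).

Definition timelike_immersion Omega f : Prop :=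
  [/\ forall p, Omega p -> AdS3 (f p),
      immersion Omega f
    & forall p, Omega p -> lorentzian (induced_metric f p)].

Definition unit_normal Omega f N : Prop :=
  smooth_on Omega N /\
  forall p, Omega p ->
    [/\ ads_ip (N p) (N p) = 1, ads_ip (N p) (f p) = 0,
        ads_ip (N p) (Dx f p) = 0 & ads_ip (N p) (Dy f p) = 0].

Definition gauss_map f N p : 'M[R]_2 := invmx (f p) *m N p.

(* S (f_x, f_y)^T = (N_x, N_y)^T, each entry of these columns being a vector
   of the ambient space gl(2, R). *)
Definition is_shape_operator f N p (S : 'M[R]_2) : Prop :=
  Dx N p = S 0 0 *: Dx f p + S 0 1 *: Dy f p /\
  Dy N p = S 1 0 *: Dx f p + S 1 1 *: Dy f p.

Definition has_mean_curvature f N p (H : R) : Prop :=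
  exists S, unique (is_shape_operator f N p) S /\ H = - 2^-1 * \tr S.

End Surfaces.

Section Frames.
Variable R : realType.

(* [Fh lambda p] is the frame at [p] with spectral parameter [lambda]; its
   value at [lambda = 0] is irrelevant. Smoothness is joint in ([p], [lambda]),
   and ['d (Fh lambda) p v] is dFh evaluated on v = (dx, dy). *)
Definition admissible_frame (Omega : set (R * R)) (Fh : R -> R * R -> 'M[R]_2)
    (A1 A2 A3 B1 B2 B3 : R * R -> R) : Prop :=
  [/\ forall lambda p, lambda != 0 -> Omega p -> \det (Fh lambda p) = 1,
      smooth_on [set q : (R * R) * R | Omega q.1 /\ q.2 != 0]
        (fun q : (R * R) * R => Fh q.2 q.1)
    & forall lambda p (v : R * R), lambda != 0 -> Omega p ->
        invmx (Fh lambda p) *m 'd (Fh lambda) p v =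
          v.1 *: ((lambda * A1 p) *: xi1 R + A2 p *: xi2 R + A3 p *: e3 R) +
          v.2 *: (B1 p *: xi1 R + (lambda^-1 * B2 p) *: xi2 R + B3 p *: e3 R)].

Definition regular_frame (Omega : set (R * R)) (A1 B2 : R * R -> R) : Prop :=
  forall p, Omega p -> A1 p != 0 /\ B2 p != 0.

End Frames.

(* Main.v *)
From HB Require Import structures.
Require Import Defs.
From mathcomp Require Import all_boot all_order all_algebra.
From mathcomp Require Import all_classical all_reals all_analysis.
From mathcomp Require Import ring.

Set Implicit Arguments.
Unset Strict Implicit.
Unset Printing Implicit Defensive.

Import Order.TTheory GRing.Theory Num.Theory.
Import numFieldNormedType.Exports.
Local Open Scope classical_set_scope.
Local Open Scope ring_scope.

(** Write f = G F^-1 and N = G e3 F^-1 with G the frame at mu and F the frame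
    at 1. For a constant matrix C, d(G C F^-1) = G (a_mu C - C a_1) F^-1, where
    a_lambda is the connection form of the frame. In a_mu - a_1 all terms that do
    not involve the spectral parameter cancel, so f_x and f_y are multiples of
    G xi1 F^-1 and G xi2 F^-1, and the metric, the normal and the shape operator
    can be read off in the fixed basis e3, xi1, xi2, because X |-> G X F^-1 is
    an isometry of gl(2, R). *)

(** * Calculus of [Ck_on] on open sets: locality, sums, linear and bilinear maps, slices *)

(** The first-order expansion at [p] depends only on the germ there, so the differential of [f] also
    serves for [g]. *)
Lemma near_eq_differentiable (R : realType) (V W : normedModType R)
    (f g : V -> W) (p : V) :
  {near p, f =1 g} -> differentiable f p -> differentiable g p.
Proof.
move=> fg df; have fgp := nbhs_singleton fg.
have Lc := diff_continuous df.
have dg : g \o shift p = cst (g p) + 'd f p +o_ 0 id.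
  apply/eqaddoP => e e0.
  have /eqaddoP/(_ e e0) fe := diff_locally df.
  have fgs : \forall h \near (0 : V), f (h + p) = g (h + p).
    have: \forall q \near p, f q = g q by [].
    by rewrite (near_shift 0 p) subr0.
  apply: filterS2 fgs fe => h fgh.
  by rewrite !fctE /= fgp fgh.
by apply/diff_locallyP; rewrite (diff_unique Lc dg).
Qed.

(** Openness turns equality on [U] into equality near each of its points, hence into equality of all
    directional derivatives on [U], and the induction goes on. This allows a derivative to be
    replaced by a formula that holds only on [U]. *)
Lemma Ck_on_eq (R : realType) (V W : normedModType R) (k : nat) (U : set V)
    (f g : V -> W) :
  open U -> (forall p, U p -> f p = g p) -> Ck_on k U f -> Ck_on k U g.
Proof.
move=> oU; elim: k f g => [|k IH] f g fg.
  move=> cf p Up; rewrite /prop_for /continuous_at -(fg _ Up).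
  apply: cvg_trans (cf p Up); apply: near_eq_cvg.
  by near=> q; apply: fg; near: q; exact: open_nbhs_nbhs.
have nfg p : U p -> \near p, f p = g p.
  by move=> Up; near=> q; apply: fg; near: q; exact: open_nbhs_nbhs.
case=> df Df; split=> [p Up|v]; last first.
  by apply: IH (Df v) => p Up; exact/near_eq_derive/nfg.
exact: near_eq_differentiable (nfg _ Up) (df p Up).
Unshelve. all: by end_near. Qed.

Lemma Ck_onW (R : realType) (V W : normedModType R) (k : nat) (U : set V)
    (f : V -> W) : Ck_on k.+1 U f -> Ck_on k U f.
Proof.
elim: k f => [|k IH] f [df Df]; first
  by move=> p Up; exact/differentiable_continuous/df.
by split=> // v; exact/IH/Df.
Qed.

Lemma smooth_on_differentiable (R : realType) (V W : normedModType R)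
    (U : set V) (f : V -> W) (p : V) :
  smooth_on U f -> U p -> differentiable f p.
Proof. by move=> /(_ 1%N)[df _]; exact: df. Qed.

Lemma Ck_onD (R : realType) (V W : normedModType R) (k : nat) (U : set V)
    (f g : V -> W) :
  open U -> Ck_on k U f -> Ck_on k U g -> Ck_on k U (fun p => f p + g p).
Proof.
move=> oU; elim: k f g => [|k IH] f g.
  by move=> cf cg p Up; apply: continuousD; [exact: cf|exact: cg].
move=> [df Df] [dg Dg]; split=> [p Up|v].
  by apply: differentiableD; [exact: df|exact: dg].
apply: Ck_on_eq (IH _ _ (Df v) (Dg v)) => // p Up.
by rewrite deriveD//; apply: diff_derivable; [exact: df|exact: dg].
Qed.

Lemma diff_linear_comp (R : realType) (V W X : normedModType R)
    (L : {linear W -> X}) (f : V -> W) (p v : V) :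
  continuous L -> differentiable f p ->
  differentiable (L \o f) p /\ 'd (L \o f) p v = L ('d f p v).
Proof.
move=> cL df; have dL : differentiable L (f p) by exact: linear_differentiable.
by split; [exact: differentiable_comp | rewrite diff_comp//= diff_lin].
Qed.

Lemma Ck_on_linear (R : realType) (V W X : normedModType R) (k : nat)
    (U : set V) (L : {linear W -> X}) (f : V -> W) :
  open U -> continuous L -> Ck_on k U f -> Ck_on k U (L \o f).
Proof.
move=> oU cL; elim: k f => [|k IH] f.
  by move=> cf p Up; apply: continuous_comp; [exact: cf|exact: cL].
move=> [df Df].
split=> [p Up|v]; first by have [] := diff_linear_comp 0 cL (df p Up).
apply: Ck_on_eq (IH _ (Df v)) => // p Up; have dfp := df p Up.
have [dLf eLf] := diff_linear_comp v cL dfp.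
by rewrite [RHS]deriveE// eLf /= deriveE.
Qed.

(** Leibniz rule, obtained from the chain rule for [b] after the pairing of [f] and [g]. *)
Lemma diff_bilinear_comp (R : realType) (V W X Y : normedModType R)
    (b : {bilinear W -> X -> Y}) (f : V -> W) (g : V -> X) (p : V) :
  continuous (fun q => b q.1 q.2) -> differentiable f p -> differentiable g p ->
  differentiable (fun q => b (f q) (g q)) p /\
  'd (fun q => b (f q) (g q)) p = (fun v => b (f p) ('d g p v) + b ('d f p v) (g p))
    :> (V -> Y).
Proof.
move=> cb df dg.
have dfg : differentiable (fun q => (f q, g q)) p by exact: differentiable_pair.
have db := differentiable_bilin (f p, g p) cb.
rewrite -[fun q => b (f q) (g q)]/((fun q => b q.1 q.2) \o (fun q => (f q, g q))).
split; first exact: differentiable_comp.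
by rewrite diff_comp // diff_pair // diff_bilin.
Qed.

Lemma Ck_on_bilinear (R : realType) (V W X Y : normedModType R) (k : nat)
    (U : set V) (b : {bilinear W -> X -> Y}) (f : V -> W) (g : V -> X) :
  open U -> continuous (fun q => b q.1 q.2) ->
  Ck_on k U f -> Ck_on k U g -> Ck_on k U (fun p => b (f p) (g p)).
Proof.
move=> oU cb; elim: k f g => [|k IH] f g.
  move=> cf cg p Up.
  apply: (@continuous_comp _ _ _ (fun q => (f q, g q)) (fun q => b q.1 q.2)).
    by apply: cvg_pair; [exact: cf|exact: cg].
  exact: cb.
move=> Cf Cg; have [df Df] := Cf; have [dg Dg] := Cg.
have dfg p Up := diff_bilinear_comp cb (df p Up) (dg p Up).
split=> [p Up|v]; first by have [] := dfg p Up.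
apply: (@Ck_on_eq _ _ _ _ _ (fun p => b (f p) ('D_v g p) + b ('D_v f p) (g p))) => //.
  move=> p Up; have [d1 d2] := dfg p Up.
  have dfp := df p Up; have dgp := dg p Up.
  by rewrite [RHS]deriveE // d2 !deriveE.
(* Each Leibniz term pairs a derivative with an undifferentiated factor, whose regularity is lowered
   by one. *)
by apply: Ck_onD => //; apply: IH; do ?[exact: Df|exact: Dg|exact: Ck_onW].
Qed.

(** The derivative of the slice along [v] is the slice of the derivative along [(v, 0)]: both are
    limits of the same difference quotients. This passes from joint smoothness in the point and the
    spectral parameter to smoothness at a fixed parameter. *)
Lemma Ck_on_slice (R : realType) (V W X : normedModType R) (k : nat)
    (U : set (V * W)) (f : V * W -> X) (w : W) :
  Ck_on k U f -> Ck_on k [set p | U (p, w)] (fun p => f (p, w)).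
Proof.
elim: k f => [|k IH] f.
  move=> cf p Up; apply: (@continuous_comp _ _ _ (fun q => (q, w)) f).
    by apply: cvg_pair; [exact: cvg_id|exact: cvg_cst].
  exact: cf.
move=> [df Df]; split=> [p Up|v].
  apply: (@differentiable_comp _ _ _ _ (fun q => (q, w)) f); last exact: df.
  exact: differentiable_pair.
suff -> : 'D_v (fun p => f (p, w)) = fun p => 'D_((v, 0) : V * W) f (p, w).
  exact: IH (Df _).
apply/funext => p; rewrite /derive.
apply: (congr1 (fun F : R -> X => lim (F @ 0^'))); apply/funext => h /=.
have -> // : h *: ((v, 0) : V * W) + (p, w) = (h *: v + p, w).
by rewrite -[LHS]/(h *: v + p, h *: 0 + w) scaler0 add0r.
Qed.

(** * Continuity of linear maps on matrices and of the matrix product, by expansion in the matrix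
    units *)

Lemma linear_mx_continuous (R : realType) (m n : nat) (W : normedModType R)
    (L : {linear 'M[R]_(m, n) -> W}) : continuous L.
Proof.
have -> : (L : _ -> _) = fun M => \sum_i \sum_j M i j *: L (delta_mx i j).
  apply/funext => M; rewrite {1}[M]matrix_sum_delta linear_sum.
  by under eq_bigr => i _ do (rewrite linear_sum; under eq_bigr do rewrite linearZ).
apply: continuous_big => [|i _]; first exact: add_continuous.
apply: continuous_big => [|j _]; first exact: add_continuous.
move=> M; apply: continuousZr_tmp; exact: coord_continuous.
Qed.

Lemma mulmx_continuous (R : realType) (m n k : nat) :
  continuous (fun q : 'M[R]_(m, n) * 'M[R]_(n, k) => q.1 *m q.2).
Proof.
have -> : (fun q : 'M[R]_(m, n) * 'M[R]_(n, k) => q.1 *m q.2) =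
    fun q => \sum_i \sum_j q.1 i j *: (delta_mx i j *m q.2).
  apply/funext => q; rewrite {1}[q.1]matrix_sum_delta mulmx_suml.
  by under eq_bigr => i _ do (rewrite mulmx_suml; under eq_bigr do rewrite -scalemxAl).
apply: continuous_big => [|i _]; first exact: add_continuous.
apply: continuous_big => [|j _]; first exact: add_continuous.
move=> q.
apply: (@continuousZ _ _ _
  (fun q : 'M[R]_(m, n) * 'M[R]_(n, k) => q.1 i j)
  (fun q => delta_mx i j *m q.2)).
  apply: (@continuous_comp _ _ _ fst (fun M : 'M[R]_(m, n) => M i j)).
    exact: cvg_fst.
  exact: coord_continuous.
apply: (@continuous_comp _ 'M[R]_(n, k) 'M[R]_(m, k) snd (mulmx (delta_mx i j))).
  exact: cvg_snd.
exact: linear_mx_continuous.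
Qed.

(** * Two-by-two matrices, the adjugate and the ambient form *)

Lemma lift01 : lift ord0 ord0 = 1 :> 'I_2.
Proof. exact/val_inj. Qed.

Lemma det_mx22 (R : comNzRingType) (A : 'M[R]_2) :
  \det A = A 0 0 * A 1 1 - A 0 1 * A 1 0.
Proof.
have l10 : lift 1 ord0 = 0 :> 'I_2 by apply/val_inj.
rewrite (expand_det_row _ 0) !big_ord_recl big_ord0 /cofactor !det_mx11 !mxE.
by rewrite /= !lift01 l10 expr0 expr1; ring.
Qed.

Lemma mx22P (T : Type) (A B : 'M[T]_2) :
  A 0 0 = B 0 0 -> A 0 1 = B 0 1 -> A 1 0 = B 1 0 -> A 1 1 = B 1 1 -> A = B.
Proof.
have ord2 (i : 'I_2) : i = 0 \/ i = 1.
  by case: i => [[|[|//]] ?]; [left|right]; apply/val_inj.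
by move=> *; apply/matrixP => i j; case: (ord2 i) => ->; case: (ord2 j) => ->.
Qed.

Lemma ads_conj_is_linear (R : realType) : linear (@ads_conj R).
Proof.
by move=> a X Y; rewrite /ads_conj linearP /= raddfD /= scalerBr scale_scalar_mx
  opprD addrACA.
Qed.

(** With this structure, conjugation falls under the results on linear maps above. *)
HB.instance Definition _ (R : realType) :=
  GRing.isLinear.Build R 'M[R]_2 'M[R]_2 *:%R (@ads_conj R)
    (@ads_conj_is_linear R).

(** In size two, [ads_conj] is the adjugate. *)
Lemma ads_conjE (R : realType) (Y : 'M[R]_2) :
  [/\ ads_conj Y 0 0 = Y 1 1, ads_conj Y 0 1 = - Y 0 1,
      ads_conj Y 1 0 = - Y 1 0 & ads_conj Y 1 1 = Y 0 0].
Proof.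
by split; rewrite /ads_conj /mxtrace !mxE !big_ord_recl big_ord0 /= ?lift01; ring.
Qed.

Lemma mulmx22E (R : realType) (X Y : 'M[R]_2) i j :
  (X *m Y) i j = X i 0 * Y 0 j + X i 1 * Y 1 j.
Proof.
by rewrite mxE !big_ord_recl big_ord0 addr0 /= lift01.
Qed.

Lemma mxtrace22E (R : realType) (X : 'M[R]_2) : \tr X = X 0 0 + X 1 1.
Proof.
by rewrite /mxtrace !big_ord_recl big_ord0 addr0 lift01.
Qed.

Lemma ads_conjM (R : realType) (X Y : 'M[R]_2) :
  ads_conj (X *m Y) = ads_conj Y *m ads_conj X.
Proof.
have [x1 x2 x3 x4] := ads_conjE X; have [y1 y2 y3 y4] := ads_conjE Y.
have [z1 z2 z3 z4] := ads_conjE (X *m Y).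
by apply: mx22P; rewrite ?z1 ?z2 ?z3 ?z4 !mulmx22E ?x1 ?x2 ?x3 ?x4
  ?y1 ?y2 ?y3 ?y4; ring.
Qed.

Lemma mulmx_ads_conj (R : realType) (X : 'M[R]_2) :
  X *m ads_conj X = (\det X)%:M.
Proof.
have [x1 x2 x3 x4] := ads_conjE X.
by apply: mx22P; rewrite mulmx22E det_mx22 ?x1 ?x2 ?x3 ?x4 mxE /= ?mulr0n ?mulr1n;
  ring.
Qed.

Lemma ads_conj_mulmx (R : realType) (X : 'M[R]_2) :
  ads_conj X *m X = (\det X)%:M.
Proof.
have [x1 x2 x3 x4] := ads_conjE X.
by apply: mx22P; rewrite mulmx22E det_mx22 ?x1 ?x2 ?x3 ?x4 mxE /= ?mulr0n ?mulr1n;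
  ring.
Qed.

(** On SL(2, R) inversion is the restriction of a linear map, so the inverse frame can be
    differentiated without a quotient rule. *)
Lemma invmx_ads_conj (R : realType) (X : 'M[R]_2) :
  \det X = 1 -> invmx X = ads_conj X.
Proof.
move=> X1; have uX : X \in unitmx by rewrite unitmxE X1 unitr1.
by rewrite -[RHS](mulKmx uX) mulmx_ads_conj X1 mulmx1.
Qed.

Lemma ads_conj_tr0 (R : realType) (X : 'M[R]_2) : \tr X = 0 -> ads_conj X = - X.
Proof. by move=> X0; rewrite /ads_conj X0 raddf0 sub0r. Qed.

Lemma ads_ipE (R : realType) (X Y : 'M[R]_2) :
  ads_ip X Y =
    - 2^-1 * (X 0 0 * Y 1 1 + X 1 1 * Y 0 0 - X 0 1 * Y 1 0 - X 1 0 * Y 0 1).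
Proof.
have [y1 y2 y3 y4] := ads_conjE Y.
by rewrite /ads_ip mxtrace22E !mulmx22E y1 y2 y3 y4; congr (_ * _); ring.
Qed.

Lemma ads_ip_det (R : realType) (X : 'M[R]_2) : ads_ip X X = - \det X.
Proof. by rewrite ads_ipE det_mx22; field. Qed.

(** Conjugation reverses products, so [F] meets its adjugate and gives [\det F]; cyclicity of the
    trace does the same for [G]. For determinants 1 this is the isometry property. *)
Lemma ads_ip_mulmx (R : realType) (G X Y F : 'M[R]_2) :
  ads_ip (G *m X *m F) (G *m Y *m F) = \det G * \det F * ads_ip X Y.
Proof.
rewrite /ads_ip.
have -> : (G *m X *m F) *m ads_conj (G *m Y *m F) =
    \det F *: (G *m (X *m ads_conj Y *m ads_conj G)).
  rewrite !ads_conjM -!mulmxA (mulmxA F) mulmx_ads_conj.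
  by rewrite mul_scalar_mx -!scalemxAr.
rewrite mxtraceZ mxtrace_mulC -!mulmxA ads_conj_mulmx mul_mx_scalar.
by rewrite -scalemxAr mxtraceZ; ring.
Qed.

(** * The connection form of the frame, and the maps G C F^-1 with their differentials *)

Lemma xi1E (R : realType) :
  [/\ xi1 R 0 0 = 0, xi1 R 0 1 = 0, xi1 R 1 0 = 1 & xi1 R 1 1 = 0].
Proof. by split; rewrite mxE. Qed.

Lemma xi2E (R : realType) :
  [/\ xi2 R 0 0 = 0, xi2 R 0 1 = 1, xi2 R 1 0 = 0 & xi2 R 1 1 = 0].
Proof. by split; rewrite mxE. Qed.

Lemma e3E (R : realType) :
  [/\ e3 R 0 0 = -1, e3 R 0 1 = 0, e3 R 1 0 = 0 & e3 R 1 1 = 1].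
Proof. by split; rewrite /e3 !mxE /= ?subr0 // sub0r. Qed.

(** The pullback of the Maurer-Cartan form by the frame at [lambda], evaluated on the tangent vector
    [v]. *)
Definition connection (R : realType) (A1 A2 A3 B1 B2 B3 : R * R -> R)
    (lambda : R) (p v : R * R) : 'M[R]_2 :=
  v.1 *: ((lambda * A1 p) *: xi1 R + A2 p *: xi2 R + A3 p *: e3 R) +
  v.2 *: (B1 p *: xi1 R + (lambda^-1 * B2 p) *: xi2 R + B3 p *: e3 R).

Lemma connectionE (R : realType) (A1 A2 A3 B1 B2 B3 : R * R -> R) lambda p v
    (a := connection A1 A2 A3 B1 B2 B3 lambda p v) :
  [/\ a 0 0 = - (v.1 * A3 p + v.2 * B3 p),
      a 0 1 = v.1 * A2 p + v.2 * (lambda^-1 * B2 p),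
      a 1 0 = v.1 * (lambda * A1 p) + v.2 * B1 p
    & a 1 1 = v.1 * A3 p + v.2 * B3 p].
Proof.
rewrite /a /connection.
move: (xi1 R) (xi2 R) (e3 R) (xi1E R) (xi2E R) (e3E R) => X Y Z.
move=> [x1 x2 x3 x4] [y1 y2 y3 y4] [z1 z2 z3 z4].
by split; rewrite !mxE ?(x1, x2, x3, x4, y1, y2, y3, y4, z1, z2, z3, z4); ring.
Qed.

Lemma frame_smooth (R : realType) (Omega : set (R * R))
    (Fh : R -> R * R -> 'M[R]_2) (A1 A2 A3 B1 B2 B3 : R * R -> R) (lambda : R) :
  admissible_frame Omega Fh A1 A2 A3 B1 B2 B3 -> lambda != 0 ->
  smooth_on Omega (Fh lambda).
Proof.
move=> [_ sF _] l0 k; have := Ck_on_slice lambda (sF k).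
(* As [lambda] is nonzero, the slice of the joint domain is all of [Omega]. *)
by congr (Ck_on _ _ _); apply/seteqP; split=> p //= [].
Qed.

Lemma frame_diff (R : realType) (Omega : set (R * R))
    (Fh : R -> R * R -> 'M[R]_2) (A1 A2 A3 B1 B2 B3 : R * R -> R)
    (lambda : R) (p v : R * R) :
  admissible_frame Omega Fh A1 A2 A3 B1 B2 B3 -> lambda != 0 -> Omega p ->
  'd (Fh lambda) p v = Fh lambda p *m connection A1 A2 A3 B1 B2 B3 lambda p v.
Proof.
move=> [dF _ eF] l0 Op; rewrite /connection -eF// mulKVmx//.
by rewrite unitmxE dF// unitr1.
Qed.

(** On [Omega] the inverse is the adjugate, which leaves a product of two linear images of frames.
    The cases [C = 1] and [C = e3] give the surface and its normal. *)
Lemma frame_sandwich_smooth (R : realType) (Omega : set (R * R))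
    (Fh : R -> R * R -> 'M[R]_2) (A1 A2 A3 B1 B2 B3 : R * R -> R)
    (mu nu : R) (C : 'M[R]_2) :
  open Omega -> admissible_frame Omega Fh A1 A2 A3 B1 B2 B3 ->
  mu != 0 -> nu != 0 ->
  smooth_on Omega (fun p => Fh mu p *m C *m invmx (Fh nu p)).
Proof.
move=> oO hF mu0 nu0 k; have [dF _ _] := hF.
apply: (@Ck_on_eq _ _ _ _ _ (fun p => (Fh mu p *m C) *m ads_conj (Fh nu p))) => //.
  by move=> p Op; rewrite invmx_ads_conj// dF.
apply: Ck_on_bilinear => //; first exact: mulmx_continuous.
  apply: (@Ck_on_linear _ _ _ _ _ _ (mulmxr C)) => //; last exact: frame_smooth hF _ _.
  exact: linear_mx_continuous.
apply: Ck_on_linear => //; last exact: frame_smooth hF _ _.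
exact: linear_mx_continuous.
Qed.

(* As the connection form is trace free, d(F^-1) = - a F^-1 is the conjugate
   of dF = F a. *)
Lemma frame_sandwich_diff (R : realType) (Omega : set (R * R))
    (Fh : R -> R * R -> 'M[R]_2) (A1 A2 A3 B1 B2 B3 : R * R -> R)
    (mu nu : R) (C : 'M[R]_2) (p v : R * R)
    (a := connection A1 A2 A3 B1 B2 B3) :
  open Omega -> admissible_frame Omega Fh A1 A2 A3 B1 B2 B3 ->
  mu != 0 -> nu != 0 -> Omega p ->
  'd (fun p => Fh mu p *m C *m invmx (Fh nu p)) p v =
    Fh mu p *m (a mu p v *m C - C *m a nu p v) *m invmx (Fh nu p).
Proof.
move=> oO hF mu0 nu0 Op; have [dF _ _] := hF.
have dmu := smooth_on_differentiable (frame_smooth hF mu0) Op.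
have dnu := smooth_on_differentiable (frame_smooth hF nu0) Op.
have cC := @linear_mx_continuous R _ _ _ (mulmxr C : {linear 'M[R]_2 -> 'M[R]_2}).
have cc := @linear_mx_continuous R _ _ _ (@ads_conj R : {linear 'M[R]_2 -> 'M[R]_2}).
have [d1 e1] := diff_linear_comp v cC dmu.
have [d2 e2] := diff_linear_comp v cc dnu.
have {}e1 := etrans e1 (congr1 (mulmxr C) (frame_diff v hF mu0 Op)).
have {}e2 := etrans e2 (congr1 (@ads_conj R) (frame_diff v hF nu0 Op)).
have [d3 e3] := diff_bilinear_comp (@mulmx_continuous R 2 2 2) d1 d2.
have fg : \near p, Fh mu p *m C *m invmx (Fh nu p) =
    (mulmxr C \o Fh mu) p *m (@ads_conj R \o Fh nu) p.
  near=> q; rewrite /= invmx_ads_conj// dF//; near: q; exact: open_nbhs_nbhs.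
have dh := smooth_on_differentiable (frame_sandwich_smooth C oO hF mu0 nu0) Op.
(* The inverse is exchanged for the adjugate inside the directional derivative, which sees only the
   germ at [p]; then the Leibniz rule applies. *)
rewrite -deriveE// (near_eq_derive _ fg) deriveE// e3.
apply: (etrans (congr2 +%R (congr1 (mulmx (Fh mu p *m C)) e2)
  (congr1 (mulmx^~ (ads_conj (Fh nu p))) e1))).
rewrite /= ads_conjM.
rewrite (@ads_conj_tr0 _ (connection _ _ _ _ _ _ nu p v)); last first.
  have [c1 c2 c3 c4] := connectionE A1 A2 A3 B1 B2 B3 nu p v.
  by rewrite mxtrace22E c1 c4 addNr.
rewrite invmx_ads_conj ?dF// addrC; move: (ads_conj (Fh nu p)) => K.
rewrite mulmxBr mulmxBl -/a.
by rewrite !(mulNmx, mulmxN) !mulmxA.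
Unshelve. all: by end_near. Qed.

(** * Shape operator and mean curvature in the moving basis *)

Lemma mulmx_sandwich_inj (R : realType) (G X Y F : 'M[R]_2) :
  G \in unitmx -> F \in unitmx -> G *m X *m F = G *m Y *m F -> X = Y.
Proof.
move=> uG uF /(congr1 (fun Z => invmx G *m Z *m invmx F)).
by rewrite -!mulmxA !mulKmx// !mulmxV// !mulmx1.
Qed.

Lemma xi12E (R : realType) (a b : R) (X := a *: xi1 R + b *: xi2 R) :
  [/\ X 0 0 = 0, X 0 1 = b, X 1 0 = a & X 1 1 = 0].
Proof.
rewrite /X; move: (xi1 R) (xi2 R) (xi1E R) (xi2E R) => X1 X2.
move=> [x1 x2 x3 x4] [y1 y2 y3 y4].
by split; rewrite !mxE ?(x1, x2, x3, x4, y1, y2, y3, y4); ring.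
Qed.

(** Multiplication by the invertible [G] and [F] is injective, so the coefficients of [xi1] and
    [xi2] can be compared on both sides of the shape equations. Division by [alpha] and [beta] then
    determines the operator, whence existence and uniqueness. *)
Lemma mean_curvature_null_frame (R : realType) (f N : R * R -> 'M[R]_2)
    (p : R * R) (G F : 'M[R]_2) (alpha beta a b c d : R) :
  G \in unitmx -> F \in unitmx -> alpha != 0 -> beta != 0 ->
  Dx f p = G *m (alpha *: xi1 R) *m F -> Dy f p = G *m (beta *: xi2 R) *m F ->
  Dx N p = G *m (a *: xi1 R + b *: xi2 R) *m F ->
  Dy N p = G *m (c *: xi1 R + d *: xi2 R) *m F ->
  has_mean_curvature f N p (- 2^-1 * (a / alpha + d / beta)).
Proof.
move=> uG uF al0 be0 fx fy Nx Ny.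
have comb s t : s *: (G *m (alpha *: xi1 R) *m F) + t *: (G *m (beta *: xi2 R) *m F) =
    G *m ((s * alpha) *: xi1 R + (t * beta) *: xi2 R) *m F.
  by rewrite -!scalerA mulmxDr mulmxDl -!scalemxAr -!scalemxAl.
have inj r s t u : G *m (r *: xi1 R + s *: xi2 R) *m F =
    G *m (t *: xi1 R + u *: xi2 R) *m F -> r = t /\ s = u.
  move=> /(mulmx_sandwich_inj uG uF) e.
  have [_ e1 e2 _] := xi12E r s; have [_ e3 e4 _] := xi12E t u.
  by rewrite e e3 in e1; rewrite e e4 in e2.
(* The rows are the coordinates of [Dx N p] and [Dy N p] in the basis [Dx f p], [Dy f p]. *)
pose S : 'M[R]_2 := \matrix_(i, j)
  if i == 0 then if j == 0 then a / alpha else b / beta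
  else if j == 0 then c / alpha else d / beta.
have [S1 S2 S3 S4] :
  [/\ S 0 0 = a / alpha, S 0 1 = b / beta, S 1 0 = c / alpha & S 1 1 = d / beta].
  by split; rewrite mxE.
exists S; split; last by rewrite mxtrace22E S1 S4.
split; first by rewrite /is_shape_operator S1 S2 S3 S4 fx fy !comb !divfK.
move=> T []; rewrite Nx Ny fx fy !comb => /inj[e1 e2] /inj[e3 e4].
by apply: mx22P; rewrite ?S1 ?S2 ?S3 ?S4 ?e1 ?e2 ?e3 ?e4 mulfK.
Qed.

Theorem proposition3p6 (R : realType) (Omega : set (R * R))
    (Fh : R -> R * R -> 'M[R]_2) (A1 A2 A3 B1 B2 B3 : R * R -> R)
    (hOmega : is_domain Omega)
    (hFh : admissible_frame Omega Fh A1 A2 A3 B1 B2 B3)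
    (hreg : regular_frame Omega A1 B2)
    (mu : R) (hmu0 : mu != 0) (hmu1 : mu != 1) :
  let F := Fh 1 in
  let f := fun p : R * R => Fh mu p *m invmx (Fh 1 p) in
  let N := fun p : R * R => Fh mu p *m e3 R *m invmx (Fh 1 p) in
  [/\ timelike_immersion Omega f,
      unit_normal Omega f N,
      forall p, Omega p -> gauss_map f N p = Ad (F p) (e3 R),
      forall p, Omega p -> has_mean_curvature f N p ((mu + 1) / (mu - 1))
    & forall p, Omega p ->
        invmx (f p) *m Dx f p = (A1 p * (mu - 1)) *: Ad (F p) (xi1 R) /\
        invmx (f p) *m Dy f p = (B2 p * (mu^-1 - 1)) *: Ad (F p) (xi2 R)].
Proof.
move=> F f N; have [[oO _] [dF _ _]] := (hOmega, hFh).
have one0 := oner_neq0 R.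
have fE : f = fun p => Fh mu p *m 1%:M *m invmx (Fh 1 p).
  by apply/funext => p; rewrite mulmx1.
have sf : smooth_on Omega f by rewrite fE; exact: frame_sandwich_smooth hFh _ _.
have sN : smooth_on Omega N by exact: frame_sandwich_smooth hFh _ _.
pose alpha p := A1 p * (mu - 1); pose beta p := B2 p * (mu^-1 - 1).
have mu10 : mu - 1 != 0 by rewrite subr_eq0.
have al0 p : Omega p -> alpha p != 0.
  by move=> /hreg[? _]; rewrite mulf_neq0.
have be0 p : Omega p -> beta p != 0.
  by move=> /hreg[_ ?]; rewrite mulf_neq0// subr_eq0 invr_eq1.
have uG p lambda : lambda != 0 -> Omega p -> Fh lambda p \in unitmx.
  by move=> l0 Op; rewrite unitmxE dF// unitr1.
have uF p : Omega p -> invmx (Fh 1 p) \in unitmx.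
  by move=> Op; rewrite unitmx_inv uG.
have dI p : Omega p -> \det (invmx (Fh 1 p)) = 1.
  by move=> Op; rewrite det_inv dF// invr1.
(* For [C = 1] the middle factor is the difference of the connection forms at [mu] and 1, in which
   only the [A1] and [B2] terms survive. *)
have df p v : Omega p -> 'd f p v =
    Fh mu p *m ((v.1 * alpha p) *: xi1 R + (v.2 * beta p) *: xi2 R) *m invmx (Fh 1 p).
  move=> Op; rewrite fE (frame_sandwich_diff _ _ oO hFh)// mulmx1 mul1mx.
  congr (_ *m _ *m _); have [c1 c2 c3 c4] := connectionE A1 A2 A3 B1 B2 B3 mu p v.
  have [d1 d2 d3 d4] := connectionE A1 A2 A3 B1 B2 B3 1 p v.
  have [e1 e2 e3 e4] := xi12E (v.1 * alpha p) (v.2 * beta p).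
  have mxB (X Y : 'M[R]_2) i j : (X - Y) i j = X i j - Y i j by rewrite !mxE.
  by apply: mx22P; rewrite mxB ?c1 ?c2 ?c3 ?c4 ?d1 ?d2 ?d3 ?d4 ?e1 ?e2 ?e3 ?e4
    /alpha /beta ?invr1; ring.
(* Since [e3] commutes with itself and anticommutes with [xi1] and [xi2], the diagonal terms cancel,
   while the off-diagonal ones add up to sign. This is the source of the factor [mu + 1]. *)
have dN p v : Omega p -> 'd N p v =
    Fh mu p *m ((- (v.1 * ((mu + 1) * A1 p) + v.2 * (2 * B1 p))) *: xi1 R +
                (v.1 * (2 * A2 p) + v.2 * ((mu^-1 + 1) * B2 p)) *: xi2 R)
      *m invmx (Fh 1 p).
  move=> Op; rewrite (frame_sandwich_diff _ _ oO hFh)//.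
  congr (_ *m _ *m _); have [c1 c2 c3 c4] := connectionE A1 A2 A3 B1 B2 B3 mu p v.
  have [d1 d2 d3 d4] := connectionE A1 A2 A3 B1 B2 B3 1 p v.
  have [t1 t2 t3 t4] := e3E R.
  pose x := - (v.1 * ((mu + 1) * A1 p) + v.2 * (2 * B1 p)).
  pose y := v.1 * (2 * A2 p) + v.2 * ((mu^-1 + 1) * B2 p).
  have [e1 e2 e3 e4] := xi12E x y.
  have mxB (X Y : 'M[R]_2) i j : (X - Y) i j = X i j - Y i j by rewrite !mxE.
  by apply: mx22P; rewrite mxB !mulmx22E ?c1 ?c2 ?c3 ?c4 ?d1 ?d2 ?d3 ?d4
    ?e1 ?e2 ?e3 ?e4 ?t1 ?t2 ?t3 ?t4 /x /y ?invr1; ring.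
have dff p : Omega p -> differentiable f p := smooth_on_differentiable sf.
have dfN p : Omega p -> differentiable N p := smooth_on_differentiable sN.
have fx p : Omega p -> Dx f p = Fh mu p *m (alpha p *: xi1 R) *m invmx (Fh 1 p).
  move=> Op; rewrite /Dx deriveE; last exact: dff.
  by rewrite df//= mul1r mul0r scale0r addr0.
have fy p : Omega p -> Dy f p = Fh mu p *m (beta p *: xi2 R) *m invmx (Fh 1 p).
  move=> Op; rewrite /Dy deriveE; last exact: dff.
  by rewrite df//= mul1r mul0r scale0r add0r.
(* The factor [Fh mu p] cancels. The case [X = e3] is the Gauss map; [xi1] and [xi2] give the two
   derivative formulas. *)
have fAd p X : Omega p ->
    invmx (f p) *m (Fh mu p *m X *m invmx (Fh 1 p)) = Ad (F p) X.
  move=> Op; have uf : f p \in unitmx by rewrite unitmx_mul uG// uF.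
  rewrite -[RHS](mulKmx uf); congr (_ *m _).
  by rewrite /Ad /f -!mulmxA mulKmx// uG.
have ipf p X Y : Omega p -> ads_ip (Fh mu p *m X *m invmx (Fh 1 p))
    (Fh mu p *m Y *m invmx (Fh 1 p)) = ads_ip X Y.
  by move=> Op; rewrite ads_ip_mulmx dF// dI// !mul1r.
(* As [xi1] and [xi2] are null with inner product 1/2, the metric is [alpha * beta] times dx dy, and
   x, y are null coordinates. *)
have gE p v w : Omega p -> induced_metric f p v w =
    2^-1 * (alpha p * beta p) * (v.1 * w.2 + v.2 * w.1).
  move=> Op; rewrite /induced_metric !df// ipf// ads_ipE.
  have [e1 e2 e3 e4] := xi12E (v.1 * alpha p) (v.2 * beta p).
  have [d1 d2 d3 d4] := xi12E (w.1 * alpha p) (w.2 * beta p).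
  by rewrite e1 e2 e3 e4 d1 d2 d3 d4; ring.
split.
- split=> [p Op||p Op].
  + by rewrite /AdS3 /= ads_ip_det det_mulmx dF// dI// mulr1.
  + split=> // p Op v w; rewrite !df// => /(mulmx_sandwich_inj (uG _ _ hmu0 Op) (uF _ Op)).
    have [_ e1 e2 _] := xi12E (v.1 * alpha p) (v.2 * beta p).
    have [_ e3 e4 _] := xi12E (w.1 * alpha p) (w.2 * beta p).
    move=> e; move: e1 e2; rewrite e e3 e4.
    move=> /(mulIf (be0 _ Op)) e5 /(mulIf (al0 _ Op)) e6.
    by rewrite [LHS]surjective_pairing [RHS]surjective_pairing e5 e6.
  (* The square of a vector (s, t) is [alpha * beta] times s t; these choices make it -1 and 1, and
     the mixed terms cancel. *)
  + exists (1, - (alpha p * beta p)^-1), (1, (alpha p * beta p)^-1).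
    by rewrite !gE//=; split; field; rewrite al0 ?be0.
- split=> // p Op; rewrite fx// fy//.
  (* By the isometry, it remains that [e3] is a unit vector orthogonal to the identity, [xi1] and
     [xi2]. *)
  have -> : f p = Fh mu p *m 1%:M *m invmx (Fh 1 p) by rewrite fE.
  rewrite !ipf//; have [t1 t2 t3 t4] := e3E R.
  have [x1 x2 x3 x4] := xi12E (alpha p) 0; have [y1 y2 y3 y4] := xi12E 0 (beta p).
  rewrite scale0r addr0 in x1 x2 x3 x4; rewrite scale0r add0r in y1 y2 y3 y4.
  rewrite !ads_ipE !(t1, t2, t3, t4, x1, x2, x3, x4, y1, y2, y3, y4) !mxE /=.
  by split; field.
- by move=> p Op; exact: fAd.
- move=> p Op.
  have Nx : Dx N p = Fh mu p *m ((- ((mu + 1) * A1 p)) *: xi1 R + (2 * A2 p) *: xi2 R)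
      *m invmx (Fh 1 p).
    rewrite /Dx deriveE; last exact: dfN.
    by rewrite dN//= !mul1r !mul0r !addr0.
  have Ny : Dy N p = Fh mu p *m ((- (2 * B1 p)) *: xi1 R + ((mu^-1 + 1) * B2 p) *: xi2 R)
      *m invmx (Fh 1 p).
    rewrite /Dy deriveE; last exact: dfN.
    by rewrite dN//= !mul1r !mul0r !add0r.
  (* [A1] and [B2] cancel in the quotients, and both diagonal entries of the shape operator equal
     [- (mu + 1) / (mu - 1)]. *)
  have := mean_curvature_null_frame (uG _ _ hmu0 Op) (uF _ Op) (al0 _ Op)
    (be0 _ Op) (fx _ Op) (fy _ Op) Nx Ny.
  congr has_mean_curvature; rewrite /alpha /beta.
  have [A10 B20] := hreg p Op.
  by field; rewrite mu10 hmu0 A10 B20 mulN1r subr_eq0 eq_sym hmu1.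
- move=> p Op; rewrite fx// fy// !fAd//.
  by rewrite /Ad -!scalemxAr -!scalemxAl.
Qed.
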